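(* Let $k$ be an algebraically closed field of characteristic zero, let $n\geq 1$ and let $1\leq a_1\leq \ldots \leq a_n$ be integers. If \[M=x_1^{a_1}\cdot\ldots\cdot x_n^{a_n}\in k[x_1,\ldots,x_n],\] then \[\mathrm{rk}(M)=\frac{1}{a_1+1}\prod_{i=1}^n (a_i+1).\]
   Context: For a homogeneous polynomial (form) $F$ of degree $d$ in a polynomial ring $k[x_1,\ldots,x_n]$, the Waring rank $\mathrm{rk}(F)$ is the least integer $s$ for which there exist linear forms $L_1,\ldots,L_s\in k[x_1,\ldots,x_n]$ such that $F=\sum_{i=1}^s L_i^d$. *)

(* Defs.v *)
From HB Require Import structures.
From mathcomp Require Import all_boot all_order all_algebra.
From mathcomp Require Import mpoly.
Set Implicit Arguments.
Unset Strict Implicit.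
Unset Printing Implicit Defensive.
Import GRing.Theory.
Local Open Scope ring_scope.

Definition waring_decomposable (k : fieldType) (n d : nat)
    (F : {mpoly k[n]}) (s : nat) : Prop :=
  exists L : 'I_s -> {mpoly k[n]},
    (forall i, L i \is 1.-homog) /\ F = \sum_(i < s) L i ^+ d.

(* [is_waring_rank d F s] says rk(F) = s for a form [F] of degree [d]. It is a
   relation because a form need not have a decomposition over every field; it
   thus asserts both that a decomposition exists and that [s] is minimal. The
   degree is an argument since the zero form is homogeneous of every degree. *)
Definition is_waring_rank (k : fieldType) (n d : nat)
    (F : {mpoly k[n]}) (s : nat) : Prop :=
  [/\ F \is d.-homog,
      waring_decomposable d F s
    & forall t : nat, waring_decomposable d F t -> (s <= t)%N].

(* Main.v *)
Require Import Defs.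
From HB Require Import structures.
From mathcomp Require Import all_boot all_order all_algebra.
From mathcomp Require Import cyclic separable cyclotomic.
From mathcomp Require Import mpoly.
Set Implicit Arguments.
Unset Strict Implicit.
Unset Printing Implicit Defensive.
Import GRing.Theory.
Local Open Scope ring_scope.

(** A linear form [L] with coefficient vector [l] satisfies
    [(L ^+ d)@_m * m! = d! * l^m] for every exponent [m] of degree [d]
    ([mcoeff_homog1X]).  Hence, in characteristic zero, [F] is the sum of the
    [L_j ^+ d] exactly when the moments [\sum_j l_j^m] have prescribed values.
    For the monomial [x^a] this says that the moment of degree [d = |a|]
    vanishes at each [m != a], and has a given nonzero value at [m = a].  Both
    halves of the theorem are statements about such point configurations.  Let
    [x_{i0}] be a variable of least exponent, and let the box consist of the
    exponents [b <= a] with [b i0 = 0]; it has [\prod_(i != i0) (a i + 1)]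
    elements.

    Upper bound ([monomial_decomposable]).  For [f] in the box take the point
    [(z_i ^+ f i)_i], where [z_i] is a primitive root of unity of order
    [a i + 1] and [z_{i0} = 1], with weight [\prod_i z_i ^+ f i].  The weighted
    moment at [m] is a product over [i] of full sums of powers of [z_i], so it
    vanishes unless [a i + 1] divides [m i + 1] for all [i != i0].  Then
    [m i = a i] or [m i >= 2 * a i + 1]; as [a i0] is the least exponent, the
    second case makes [|m| > |a|] ([dvd_slice_eq]).  Weights are absorbed into
    the linear forms by extracting [d]-th roots.

    Lower bound ([card_points_ge]).  With fewer points than the box has elements,
    the monomials of the box, seen as functions on the points lying in the chart
    [x_{i0} != 0], satisfy a linear relation: a polynomial vanishes at these
    points.  Homogenising it with powers of [x_{i0}], with at least one factor
    [x_{i0}] to spare because [a i0 >= 1], gives a form that vanishes at all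
    points.  Multiplied by the monomial that moves one of its terms of top degree
    to [x^a], it becomes a combination of moments equal to zero, in which only
    the moment at [a] survives: a contradiction. *)

(** * Coefficients of powers of linear forms *)

(** A form [L] of degree 1, as a point of affine space. *)
Definition point (R : nzRingType) n (L : {mpoly R[n]}) (i : 'I_n) : R :=
  L@_U_(i).

Definition mnm_fact n (m : 'X_{1..n}) : nat := (\prod_(i < n) (m i)`!)%N.

Lemma mderiv_homog1 (R : nzRingType) n (L : {mpoly R[n]}) i :
  L \is 1.-homog -> L^`M(i) = (point L i)%:MP.
Proof.
move=> homL; apply/mpolyP=> m; rewrite mcoeff_deriv mcoeffC.
have [->|nz_m] := eqVneq m 0%MM; first by rewrite add0m mnmE mulr1.
rewrite (dhomog_nemf_coeff homL) ?mul0rn ?mulr0 //.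
by rewrite /= mdegD mdeg1 addn1 eqSS mdeg_eq0.
Qed.

Lemma mderivXn (R : comNzRingType) n (p : {mpoly R[n]}) i d :
  (p ^+ d.+1)^`M(i) = (p^`M(i) * p ^+ d) *+ d.+1.
Proof.
elim: d => [|d IHd]; first by rewrite expr1 expr0 mulr1.
rewrite exprS mderivM IHd mulrnAr mulrCA -exprS [RHS]mulrS.
by congr (_ + _).
Qed.

Lemma homog1X (R : nzRingType) n (L : {mpoly R[n]}) d :
  L \is 1.-homog -> L ^+ d \is d.-homog.
Proof. by move/(dhomogMn d); rewrite mul1n. Qed.

(** The multinomial theorem with denominators cleared, so that it holds over any
    commutative ring.  It comes from differentiating [L ^+ d.+1] once: this lowers
    both the degree and the exponent [m], and brings out a coordinate of [L]. *)
Lemma mcoeff_homog1X (R : comNzRingType) n (L : {mpoly R[n]}) d m :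
    L \is 1.-homog -> mdeg m = d ->
  (L ^+ d)@_m *+ mnm_fact m = (\prod_(i < n) point L i ^+ m i) *+ d`!.
Proof.
move=> homL; elim: d m => [|d IHd] m deg_m.
  have/eqP-> : m == 0%MM by rewrite -mdeg_eq0 deg_m.
  rewrite expr0 mcoeff1 eqxx /mnm_fact !big1 // => i _; rewrite mnm0E ?expr0 //.
have [i nz_mi] : exists i, m i != 0%N.
  apply/existsP; apply: contraPT deg_m => /existsPn zm.
  by rewrite mdegE big1 // => i _; apply/eqP; have := zm i; rewrite negbK.
have def_m : m = (m - U_(i) + U_(i))%MM by rewrite submK // lep1mP.
set m1 := (m - U_(i))%MM in def_m.
have deg1 : mdeg m1 = d.
  by move: deg_m; rewrite {1}def_m mdegD mdeg1 addn1 => -[].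
have mi j : m j = (m1 j + (i == j))%N by rewrite {1}def_m mnmDE mnm1E.
have fact_m : mnm_fact m = ((m1 i).+1 * mnm_fact m1)%N.
  rewrite /mnm_fact (bigD1 i) //= [in RHS](bigD1 i) //= mi eqxx /= addn1 factS.
  rewrite -!mulnA; congr (_ * (_ * _))%N.
  by apply: eq_bigr => j; rewrite mi eq_sym => /negbTE->; rewrite addn0.
rewrite fact_m {1}def_m mulrnA -mcoeff_deriv mderivXn mderiv_homog1 // mcoeffMn.
rewrite mcoeffCM -mulrnA mulnC mulrnA -mulrnAr IHd // mulrnAr -mulrnA mulnC -factS.
congr (_ *+ _); rewrite (bigD1 i) //= [in RHS](bigD1 i) //=.
rewrite mi eqxx /= addn1 exprS mulrA.
congr (_ * _ * _).
by apply: eq_bigr => j; rewrite mi eq_sym => /negbTE->; rewrite addn0.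
Qed.

Lemma mcoeff_sum_homog1X (R : comNzRingType) n (J : Type) (r : seq J)
    (P : pred J) (L : J -> {mpoly R[n]}) d m :
    (forall j, L j \is 1.-homog) -> mdeg m = d ->
  (\sum_(j <- r | P j) L j ^+ d)@_m *+ mnm_fact m =
  (\sum_(j <- r | P j) \prod_(i < n) point (L j) i ^+ m i) *+ d`!.
Proof.
move=> homL deg_m; rewrite raddf_sum /= -!sumrMnl.
by apply: eq_bigr => j _; rewrite mcoeff_homog1X.
Qed.

Lemma natr_neq0_pchar0 (R : idomainType) (s : nat) :
  [pchar R] =i pred0 -> (0 < s)%N -> s%:R != 0 :> R.
Proof. by move=> char0; rewrite (pcharf0P R).1 // -lt0n. Qed.

Lemma mnm_fact_gt0 n (m : 'X_{1..n}) : (0 < mnm_fact m)%N.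
Proof. by apply: prodn_gt0 => i; apply: fact_gt0. Qed.

Lemma sum_homog1X_eq (k : fieldType) n d (F : {mpoly k[n]}) (J : Type)
    (r : seq J) (P : pred J) (L : J -> {mpoly k[n]}) :
    [pchar k] =i pred0 -> F \is d.-homog -> (forall j, L j \is 1.-homog) ->
    (forall m, mdeg m = d ->
       F@_m *+ mnm_fact m =
       (\sum_(j <- r | P j) \prod_(i < n) point (L j) i ^+ m i) *+ d`!) ->
  F = \sum_(j <- r | P j) L j ^+ d.
Proof.
move=> char0 homF homL moments; apply/mpolyP => m.
have [deg_m|deg_m] := eqVneq (mdeg m) d; last first.
  rewrite !(@dhomog_nemf_coeff _ _ mdeg d) // rpred_sum // => j _.
  exact: homog1X.
have fact_neq0 := natr_neq0_pchar0 char0 (mnm_fact_gt0 m).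
by apply: (mulIf fact_neq0); rewrite !mulr_natr moments // mcoeff_sum_homog1X.
Qed.

Lemma prod_mpolyX (R : comNzRingType) n (a : 'I_n -> nat) :
  \prod_(i < n) 'X_i ^+ a i = 'X_[[multinom a i | i < n]] :> {mpoly R[n]}.
Proof. by rewrite mpolyXE_id; apply: eq_bigr => i _; rewrite mnmE. Qed.

Lemma waring_decomposable_set (k : fieldType) n d (F : {mpoly k[n]})
    (J : finType) (A : {set J}) (L : J -> {mpoly k[n]}) :
    (forall j, L j \is 1.-homog) -> F = \sum_(j in A) L j ^+ d ->
  waring_decomposable d F #|A|.
Proof.
move=> homL ->; exists (fun i => L (enum_val i)).
by split=> [i|]; [exact: homL | rewrite big_enum_val].
Qed.

(** * Roots of unity *)

Lemma closed_nthroot (k : closedFieldType) d (c : k) :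
  (0 < d)%N -> exists x, x ^+ d = c.
Proof.
move=> d_gt0.
have [x x_root] := solve_monicpoly (fun i => if i == 0%N then c else 0) d_gt0.
exists x; rewrite {}x_root; case: d d_gt0 => // d _; rewrite big_ord_recl /= mulr1.
by rewrite big1 ?addr0 // => i _; rewrite mul0r.
Qed.

(** In characteristic zero ['X^w - 1] is separable, so it has [w] distinct roots,
    and a finite group of roots of unity in a field is cyclic. *)
Lemma closed_prim_root (k : closedFieldType) w :
  [pchar k] =i pred0 -> (0 < w)%N -> exists z : k, w.-primitive_root z.
Proof.
move=> char0 w_gt0; set p := 'X^w - 1 : {poly k}.
have [r] := closed_field_poly_normal p.
have -> : lead_coef p = 1 by rewrite /p -polyC1 lead_coefXnsubC.
rewrite scale1r => def_p.
have : has w.-primitive_root r.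
  apply: has_prim_root => //.
  - apply/allP=> x xr; rewrite /root_of_unity -/p def_p root_prod_XsubC //.
  - rewrite -separable_prod_XsubC -def_p separable_Xn_sub_1 //.
    exact: natr_neq0_pchar0.
  rewrite -ltnS -(size_prod_XsubC r id) -def_p /p -polyC1 size_XnsubC //.
by case/hasP=> z _ ?; exists z.
Qed.

(** For [t] not divisible by [w], the sum is geometric of ratio [z ^+ t != 1], and
    its closed form has numerator [z ^+ (t * w) - 1 = 0]. *)
Lemma sum_prim_root (R : idomainType) w (z : R) t : w.-primitive_root z ->
  \sum_(j < w) z ^+ (j * t) = if (w %| t)%N then w%:R else 0.
Proof.
move=> prim_z; case: ifPn => dvd_wt.
  rewrite (eq_bigr (fun=> 1)) ?sumr_const ?card_ord // => j _.
  by apply/eqP; rewrite -(prim_order_dvd prim_z) dvdn_mull.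
have zt_neq1 : z ^+ t - 1 != 0 by rewrite subr_eq0 -(prim_order_dvd prim_z).
apply: (mulfI zt_neq1); rewrite mulr0.
under eq_bigr => j _ do rewrite mulnC exprM.
by rewrite -subrX1 -exprM mulnC exprM (prim_expr_order prim_z) expr1n subrr.
Qed.

(** * Boxes of exponents *)

(** Sums over the box need a finite type of exponents: [D] is any common bound of
    the widths [w i]. *)
Definition box n D (w : 'I_n -> nat) : {set {ffun 'I_n -> 'I_D}} :=
  [set f : {ffun 'I_n -> 'I_D} | [forall i, (f i < w i)%N]].

Lemma big_box (R : comPzSemiRingType) n D (w : 'I_n -> nat)
    (F : 'I_n -> nat -> R) : (forall i, w i <= D)%N ->
  \sum_(f in box D w) \prod_(i < n) F i (f i) =
  \prod_(i < n) \sum_(j < w i) F i j.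
Proof.
move=> le_wD; under [RHS]eq_bigr => i _ do
  rewrite (big_ord_widen D (F i) (le_wD i)).
rewrite (bigA_distr_big_dep (fun i (j : 'I_D) => j < w i)%N (fun i j => F i j)).
by apply: eq_bigl => f; rewrite inE; apply/forallP/familyP.
Qed.

Lemma card_box n D (w : 'I_n -> nat) : (forall i, w i <= D)%N ->
  #|box D w| = (\prod_(i < n) w i)%N.
Proof.
move=> le_wD; have := @big_box nat n D w (fun _ _ => 1%N) le_wD.
under eq_bigr => f _ do rewrite big1_eq.
rewrite sum1_card => ->; apply: eq_bigr => i _.
by rewrite sum1_card card_ord.
Qed.

(** The widths of the box of exponents [b <= a] with [b i0 = 0]. *)
Definition slice_width n (i0 : 'I_n) (a : 'I_n -> nat) (i : 'I_n) : nat :=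
  if i == i0 then 1 else (a i).+1.

Lemma slice_width_le n (i0 : 'I_n) a i :
  (slice_width i0 a i <= (\sum_(j < n) a j).+1)%N.
Proof.
rewrite /slice_width; case: ifP => // _.
by rewrite ltnS (bigD1 i) //= leq_addr.
Qed.

(** Outside [i0], the divisibility gives [m i = a i] or [m i >= 2 * a i + 1].
    The second case exceeds [a i] by more than [a i0], the total that [m i0 >= 0]
    could give back, so the sums of [m] and [a] would differ. *)
Lemma dvd_slice_eq n (i0 : 'I_n) (a : 'I_n -> nat) (m : 'I_n -> nat) :
    (forall i, a i0 <= a i)%N -> (\sum_i m i = \sum_i a i)%N ->
    (forall i, slice_width i0 a i %| (m i).+1)%N ->
  forall i, m i = a i.
Proof.
move=> a_min sum_eq dvd_m.
have m_ge i : i != i0 -> (a i <= m i)%N.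
  by move=> ne; have := dvd_m i; rewrite /slice_width (negbTE ne); apply: dvdn_leq.
have m_eq i : i != i0 -> m i = a i.
  move=> ne; apply/eqP; rewrite eqn_leq m_ge // andbT leqNgt; apply/negP => lt_am.
  have := dvd_m i; rewrite /slice_width (negbTE ne) => /dvdnP[t def_m].
  have m_large : (a i + (a i0).+1 <= m i)%N.
    rewrite -ltnS def_m; case: t def_m => [|[|t]] def_m //.
      by move: lt_am; rewrite -ltnS def_m mul1n ltnn.
    by rewrite !mulSn addSn ltnS leq_add2l (leq_trans _ (leq_addr _ _)) ?ltnS.
  have /negP[] : ~~ (\sum_i a i < \sum_i m i)%N by rewrite sum_eq ltnn.
  rewrite (bigD1 i) // [X in (_ < X)%N](bigD1 i) //=.
  have ne' : i0 != i by rewrite eq_sym.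
  rewrite (bigD1 i0) // [X in (_ < _ + X)%N](bigD1 i0) //= !addnA -addSn -addnS.
  apply: leq_add; first exact: leq_trans m_large (leq_addr _ _).
  by apply: leq_sum => j /andP[_ /m_ge].
(* The coordinate at [i0] is then forced by the equality of the sums. *)
move=> i; have [->|/m_eq//] := eqVneq i i0.
have rest_eq : (\sum_(j | j != i0) m j = \sum_(j | j != i0) a j)%N.
  exact: eq_bigr.
apply/eqP; rewrite -(eqn_add2r (\sum_(j | j != i0) a j)) -{1}rest_eq.
by move: sum_eq; rewrite (bigD1 i0) //= [X in _ = X](bigD1 i0) //= => ->.
Qed.

(** * Upper bound *)

(** Explicitly, [x^a] is up to a scalar the sum over [f] in the box of
    [(\prod_i z_i ^+ f i) * (\sum_i z_i ^+ f i * x_i) ^+ d]: the averages over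
    roots of unity select the exponents [m] with [w i %| (m i).+1]. *)
Lemma monomial_decomposable (k : closedFieldType) n (i0 : 'I_n)
    (a : 'I_n -> nat) :
    [pchar k] =i pred0 -> (0 < a i0)%N -> (forall i, a i0 <= a i)%N ->
  waring_decomposable (\sum_(i < n) a i)
    (\prod_(i < n) 'X_i ^+ a i : {mpoly k[n]})
    #|box (\sum_(i < n) a i).+1 (slice_width i0 a)|.
Proof.
move=> char0 a_gt0 a_min; set d := (\sum_(i < n) a i)%N.
set w := slice_width i0 a.
have w_gt0 i : (0 < w i)%N by rewrite /w /slice_width; case: ifP.
have d_gt0 : (0 < d)%N by rewrite /d (bigD1 i0) //= addn_gt0 a_gt0.
have /fin_all_exists [z prim_z] i : exists z : k, (w i).-primitive_root z.
  exact: closed_prim_root.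
have le_wD i : (w i <= d.+1)%N by exact: slice_width_le.
pose am := [multinom a i | i < n].
(* The sum over the box is [d! * \prod_i w i / a!] times the monomial; [C]
   is the inverse of that scalar. *)
pose C : k := (mnm_fact am)%:R / (d`!%:R * (\prod_(i < n) w i)%:R).
have /fin_all_exists[rho rhoE] (f : {ffun 'I_n -> 'I_d.+1}) :
    exists x, x ^+ d = C * \prod_(i < n) z i ^+ f i.
  exact: closed_nthroot.
pose L f : {mpoly k[n]} := \sum_(i < n) (rho f * z i ^+ f i) *: 'X_i.
have homL f : L f \is 1.-homog.
  by apply: rpred_sum => i _; rewrite dhomogZ // dhomogX /= mdeg1.
have pointL f i : point (L f) i = rho f * z i ^+ f i.
  rewrite /point /L raddf_sum (bigD1 i) //= mcoeffZ mcoeffXU eqxx mulr1.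
  by rewrite big1 ?addr0 // => j /negbTE ne; rewrite mcoeffZ mcoeffXU ne mulr0.
have deg_am : mdeg am = d by rewrite mdegE; apply: eq_bigr => i _; rewrite mnmE.
rewrite prod_mpolyX -/am; apply: (waring_decomposable_set homL).
apply: sum_homog1X_eq => // [|m deg_m]; first by rewrite dhomogX /= deg_am.
rewrite mcoeffX.
have -> : \sum_(f in box d.+1 w) \prod_(i < n) point (L f) i ^+ m i =
    C * \prod_(i < n) (if (w i %| (m i).+1)%N then (w i)%:R else 0).
  (* The weight raises the exponent of [z_i ^+ f i] from [m i] to [(m i).+1]. *)
  have termE f : \prod_(i < n) point (L f) i ^+ m i =
      C * \prod_(i < n) z i ^+ (f i * (m i).+1).
    under eq_bigr => i _ do rewrite pointL exprMn -exprM.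
    rewrite big_split /= prodrXr -mdegE deg_m rhoE -mulrA -big_split /=.
    by congr (_ * _); apply: eq_bigr => i _; rewrite -exprD mulnS.
  under eq_bigr => f _ do rewrite termE.
  rewrite -mulr_sumr (big_box (fun i j => z i ^+ (j * (m i).+1))) //.
  by congr (_ * _); apply: eq_bigr => i _; rewrite sum_prim_root.
have [<-|ne_m] := eqVneq am m.
  rewrite (eq_bigr (fun i => (w i)%:R)) => [|i _]; last first.
    rewrite mnmE ifT // /w /slice_width.
    by case: (i == i0); rewrite ?dvd1n ?dvdnn.
  rewrite -natr_prod -mulr_natr mul1r -[RHS]mulr_natr /C.
  rewrite -[RHS]mulrA [X in _ * X]mulrC divfK // mulf_neq0 //.
    exact/natr_neq0_pchar0/fact_gt0.
  exact/natr_neq0_pchar0/prodn_gt0.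
have [i not_dvd] : exists i, ~~ (w i %| (m i).+1)%N.
  apply/existsP; apply: contraR ne_m => /existsPn dvd_m.
  apply/eqP/mnmP => i; rewrite mnmE; apply/esym.
  apply: (@dvd_slice_eq _ i0) => // [|j]; first by rewrite -mdegE.
  by have := dvd_m j; rewrite negbK.
by rewrite (bigD1 i) //= (negbTE not_dvd) mul0r mulr0 !mul0rn.
Qed.

(** * Lower bound *)

Lemma linear_dependence (k : fieldType) (J : finType) (A : {set J}) t
    (v : J -> 'I_t -> k) : (t < #|A|)%N ->
  exists c : J -> k, (exists2 b, b \in A & c b != 0) /\
    forall j, \sum_(b in A) c b * v b j = 0.
Proof.
move=> lt_tA; pose V := \matrix_(i < #|A|, j < t) v (enum_val i) j.
have kerV : kermx V != 0.
  rewrite kermx_eq0 /row_free neq_ltn.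
  by rewrite (leq_ltn_trans (rank_leq_col V)).
pose u := nz_row (kermx V).
have uV : u *m V = 0 by apply/sub_kermxP; apply: nz_row_sub.
have [i nz_ui] : exists i, u 0 i != 0 by apply/rV0Pn; rewrite nz_row_eq0.
have bA := enum_valP i.
exists (fun b => u 0 (enum_rank_in bA b)); split.
  by exists (enum_val i); rewrite ?enum_valK_in.
move=> j; transitivity ((u *m V) 0 j); last by rewrite uV mxE.
rewrite [LHS]big_enum_val mxE.
by apply: eq_bigr => l _; rewrite enum_valK_in mxE.
Qed.

(** The heart of the lower bound, as a statement on [t] points [l j] whose moment
    of degree [|a|] is nonzero at [a] only. *)
Lemma card_points_ge (k : fieldType) n (i0 : 'I_n) (a : 'I_n -> nat) t
    (l : 'I_t -> 'I_n -> k) :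
    (0 < a i0)%N ->
    \sum_(j < t) \prod_(i < n) l j i ^+ a i != 0 ->
    (forall (m : 'I_n -> nat) i, (\sum_i m i = \sum_i a i)%N -> m i != a i ->
       \sum_(j < t) \prod_(i < n) l j i ^+ m i = 0) ->
  (#|box (\sum_(i < n) a i).+1 (slice_width i0 a)| <= t)%N.
Proof.
set d := (\sum_(i < n) a i)%N; set A := box _ _.
move=> a_gt0 moment_a moments; rewrite leqNgt; apply/negP => lt_tA.
(* The monomials of the box in the affine coordinates [x_i / x_{i0}]. *)
pose v (b : {ffun 'I_n -> 'I_d.+1}) j := \prod_(i < n) (l j i / l j i0) ^+ b i.
have [c [[b1 b1A nz_c1] dep]] := linear_dependence v lt_tA.
pose deg (b : {ffun 'I_n -> 'I_d.+1}) := (\sum_(i < n) b i)%N.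
pose P b := (b \in A) && (c b != 0).
have Pb1 : P b1 by rewrite /P b1A.
case: (@arg_maxnP _ b1 P deg Pb1) => b0 /andP[b0A nz_c0] b0_max.
have box0 b : b \in A -> b i0 = 0%N :> nat.
  rewrite inE => /forallP/(_ i0); rewrite /slice_width eqxx ltnS leqn0.
  by move/eqP.
have boxS b i : b \in A -> i != i0 -> (b i <= a i)%N.
  by rewrite inE => /forallP/(_ i) + ne; rewrite /slice_width (negbTE ne) ltnS.
have degE b : b \in A -> deg b = (\sum_(i < n | i != i0) b i)%N.
  by move=> bA; rewrite /deg (bigD1 i0) //= box0.
(* The term [b] of the relation, homogenised by powers of [x_{i0}] and multiplied
   by [x^(a - b0)], so that the term [b0] becomes [x^a].  By maximality of
   [deg b0], [deg b0 - deg b] is a true difference, so [mb b] has degree [|a|];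
   its exponent at [i0] is at least [a i0 > 0]. *)
pose mb (b : {ffun 'I_n -> 'I_d.+1}) i : nat :=
  if i == i0 then (a i0 + (deg b0 - deg b))%N else (a i - b0 i + b i)%N.
have mbN b i : i != i0 -> mb b i = (a i - b0 i + b i)%N.
  by rewrite /mb => /negbTE->.
have deg_mb b : P b -> (\sum_i mb b i = d)%N.
  move=> Pb; have le_deg : (deg b <= deg b0)%N by apply: b0_max.
  case/andP: Pb => bA _.
  rewrite (bigD1 i0) //= (eq_bigr _ (mbN b)) big_split /= -degE //.
  rewrite /mb eqxx -addnA /d [RHS](bigD1 i0) //=; congr (_ + _)%N.
  rewrite addnCA subnK // degE // -big_split /=.
  by apply: eq_bigr => i ne; rewrite subnK ?boxS.
(* [K j] does not depend on [b], so the relation between the [v b j] becomes one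
   between the monomials of exponent [mb b] at the point [l j]. *)
pose K j := l j i0 ^+ (a i0 + deg b0) *
  \prod_(i < n | i != i0) l j i ^+ (a i - b0 i).
have eval_mb b j : P b -> \prod_(i < n) l j i ^+ mb b i = K j * v b j.
  move=> Pb; have le_deg : (deg b <= deg b0)%N by apply: b0_max.
  case/andP: Pb => bA _; rewrite (bigD1 i0) //= {1}/mb eqxx /K.
  (* Outside the chart both sides vanish, because [a i0 > 0]. *)
  have [->|nz_l] := eqVneq (l j i0) 0.
    by rewrite !expr0n !addn_eq0 !eqn0Ngt a_gt0 !mul0r.
  have -> : v b j = (l j i0 ^+ deg b)^-1 * \prod_(i < n | i != i0) l j i ^+ b i.
    rewrite /v (bigD1 i0) //= box0 // expr0 mul1r.
    under eq_bigr => i _ do rewrite exprMn exprVn.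
    rewrite big_split /= mulrC; congr (_ * _).
    by rewrite prodfV prodrXr -degE.
  rewrite mulrACA -big_split /= addnBA //.
  rewrite (@expfB_cond k (a i0 + deg b0)%N (deg b)); last first.
    by rewrite (negbTE nz_l) add0n (leq_trans le_deg) // leq_addl.
  by congr (_ * _); apply: eq_bigr => i ne; rewrite mbN // exprD.
have mb0 i : mb b0 i = a i.
  have [->|ne] := eqVneq i i0; first by rewrite /mb eqxx subnn addn0.
  by rewrite mbN // subnK // boxS.
have total : \sum_(b in A) c b * (\sum_(j < t) \prod_(i < n) l j i ^+ mb b i) = 0.
  transitivity (\sum_(j < t) K j * \sum_(b in A) c b * v b j).
    under [RHS]eq_bigr => j _ do rewrite mulr_sumr.
    rewrite exchange_big /=; apply: eq_bigr => b bA.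
    have [-> | nz_cb] := eqVneq (c b) 0.
      by rewrite mul0r big1 // => j _; rewrite mul0r mulr0.
    have Pb : P b by rewrite /P bA.
    rewrite mulr_sumr; apply: eq_bigr => j _.
    rewrite (eval_mb b j Pb); exact: mulrCA.
  by rewrite big1 // => j _; rewrite dep mulr0.
move/eqP: total; rewrite (bigD1 b0) //= [X in _ + X]big1 => [|b /andP[bA ne_b]].
  under eq_bigr => j _ do under eq_bigr => i _ do rewrite mb0.
  by rewrite addr0 mulf_eq0 (negbTE nz_c0) (negbTE moment_a).
have [-> | nz_cb] := eqVneq (c b) 0; first by rewrite mul0r.
have [i ne_bi] : exists i, b i != b0 i.
  by apply/existsP; apply: contraR ne_b => /existsPn eq_b; apply/eqP/ffunP => i;
     apply/eqP; have := eq_b i; rewrite negbK.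
have ne_i : i != i0.
  by apply: contraNneq ne_bi => ->; rewrite -val_eqE /= !box0.
rewrite (moments _ i) ?mulr0 ?deg_mb // /P ?bA // -mb0 !mbN //.
by rewrite eqn_add2l.
Qed.

Lemma monomial_rank_ge (k : fieldType) n (i0 : 'I_n) (a : 'I_n -> nat) t :
    [pchar k] =i pred0 -> (0 < a i0)%N ->
  waring_decomposable (\sum_(i < n) a i)
    (\prod_(i < n) 'X_i ^+ a i : {mpoly k[n]}) t ->
  (#|box (\sum_(i < n) a i).+1 (slice_width i0 a)| <= t)%N.
Proof.
move=> char0 a_gt0 [L [homL def_M]]; set d := (\sum_(i < n) a i)%N in def_M *.
pose mnm m : 'X_{1..n} := [multinom m i | i < n].
have deg_mnm m : (\sum_i m i = d)%N -> mdeg (mnm m) = d.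
  by move=> <-; rewrite mdegE; apply: eq_bigr => i _; rewrite mnmE.
have moment m : (\sum_i m i = d)%N ->
    (mnm a == mnm m)%:R *+ mnm_fact (mnm m) =
    (\sum_(j < t) \prod_(i < n) point (L j) i ^+ m i) *+ d`!.
  move=> /deg_mnm deg_m; rewrite -(@mcoeffX n k) -prod_mpolyX def_M.
  rewrite mcoeff_sum_homog1X //; congr (_ *+ _); apply: eq_bigr => j _.
  by apply: eq_bigr => i _; rewrite mnmE.
apply: (@card_points_ge k n i0 a t (fun j i => point (L j) i)) => // [|m i sum_m ne_m].
  have := moment a erefl; rewrite eqxx => moment_a; apply: contraTneq isT => sum0.
  move/eqP: moment_a; rewrite sum0 mul0rn.
  by rewrite (negbTE (natr_neq0_pchar0 char0 (mnm_fact_gt0 _))).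
have := moment m sum_m; case: eqP => [/mnmP/(_ i)|_].
  by rewrite !mnmE => eq_am; rewrite eq_am eqxx in ne_m.
rewrite mul0rn -mulr_natr => /esym/eqP; rewrite mulf_eq0.
by rewrite (negbTE (natr_neq0_pchar0 char0 (fact_gt0 d))) orbF => /eqP.
Qed.

(** * The rank *)

Lemma prod_slice_width (F : fieldType) n (i0 : 'I_n) (a : 'I_n -> nat) :
    (a i0 + 1)%:R != 0 :> F ->
  (\prod_(i < n) slice_width i0 a i)%:R =
  1 / (a i0 + 1)%:R * \prod_(i < n) (a i + 1)%:R :> F.
Proof.
move=> nz_a; rewrite (bigD1 i0) // [in RHS](bigD1 i0) //= {1}/slice_width eqxx.
rewrite mul1n div1r mulKf // natr_prod.
by apply: eq_bigr => i /negbTE ne; rewrite /slice_width ne addn1.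
Qed.

Theorem proposition3p1 (k : closedFieldType) (char0 : [pchar k] =i pred0)
    (n : nat) (hn : (1 <= n)%N) (a : 'I_n -> nat)
    (a1_ge1 : (1 <= a (Ordinal hn))%N)
    (a_mono : forall i j : 'I_n, (i <= j)%N -> (a i <= a j)%N) :
  exists r : nat,
    is_waring_rank (\sum_(i < n) a i)%N
      (\prod_(i < n) 'X_i ^+ a i : {mpoly k[n]}) r /\
    r%:R = 1 / (a (Ordinal hn) + 1)%:R * \prod_(i < n) (a i + 1)%:R :> rat.
Proof.
set i0 := Ordinal hn in a1_ge1 *.
have a_min i : (a i0 <= a i)%N by apply: a_mono.
have dec := monomial_decomposable char0 a1_ge1 a_min.
exists #|box (\sum_(i < n) a i).+1 (slice_width i0 a)|; split.
  split=> // [|t]; last exact: monomial_rank_ge.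
  have [L [homL ->]] := dec; rewrite rpred_sum // => j _.
  exact: homog1X.
rewrite card_box; last exact: slice_width_le.
by apply: prod_slice_width; rewrite addn1 Num.Theory.pnatr_eq0.
Qed.
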